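(* Let $(\mathfrak{g},[\cdot,\cdot],\alpha)$ be a regular hom-Lie algebra, $(V,\beta,\rho)$ a representation with $\beta$ invertible, and $T:V\to\mathfrak{g}$ an $\mathcal{O}$-operator on $(\mathfrak{g},[\cdot,\cdot],\alpha)$ with respect to $(V,\beta,\rho)$. Let $T^1_t:=T+t\mathfrak{T}_1$ and $T^2_t:=T+t\mathfrak{T}_2$ be two equivalent linear deformations of $T$. Then $\mathfrak{T}_1$ and $\mathfrak{T}_2$ belong to the same cohomology class in $\widetilde{H}^1_{\beta,\alpha}(V,\mathfrak{g})$.
   Context: The base field $k$ has characteristic zero. A (multiplicative) hom-Lie algebra $(\mathfrak{g},[\cdot,\cdot],\alpha)$ is a vector space $\mathfrak{g}$ with a skew-symmetric bilinear bracket and a linear map $\alpha:\mathfrak{g}\to\mathfrak{g}$ with $\alpha[x,y]=[\alpha(x),\alpha(y)]$ and $[\alpha(x),[y,z]]+[\alpha(y),[z,x]]+[\alpha(z),[x,y]]=0$; it is regular if $\alpha$ is invertible. A representation $(V,\beta,\rho)$ is a vector space $V$, $\beta\in\mathrm{End}(V)$ and a linear map $\rho:\mathfrak{g}\to\mathrm{End}(V)$ with $\rho(\alpha(x))(\beta(v))=\beta(\rho(x)(v))$ and $\rho([x,y])(\beta(v))=\rho(\alpha(x))\rho(y)(v)-\rho(\alpha(y))\rho(x)(v)$. Write $\{x,v\}:=\rho(x)(v)$. An $\mathcal{O}$-operator on $(\mathfrak{g},[\cdot,\cdot],\alpha)$ with respect to $(V,\beta,\rho)$ is a linear map $T:V\to\mathfrak{g}$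 with $T\circ\beta=\alpha\circ T$ and $[Tu,Tv]=T(\{Tu,v\}-\{Tv,u\})$ for all $u,v\in V$. For $n\ge1$, $C^n_{\beta,\alpha}(V,\mathfrak{g})$ is the space of linear maps $P:\wedge^nV\to\mathfrak{g}$ with $\alpha(P(v_1,\dots,v_n))=P(\beta(v_1),\dots,\beta(v_n))$, and $C^0_{\beta,\alpha}(V,\mathfrak{g})=\{x\in\mathfrak{g}\mid\alpha(x)=x\}$. With $\rho_T(v)(x)=[Tv,x]+T\{x,v\}$ and $[v,w]^c=\{Tv,w\}-\{Tw,v\}$, the differential is $\delta_{\beta,\alpha}(x)(v)=\rho_T(\beta^{-1}(v))(x)$ on $0$-cochains and, for $P\in C^n_{\beta,\alpha}(V,\mathfrak{g})$, $n\ge1$, $$\delta_{\beta,\alpha}P(v_1,\dots,v_{n+1})=\sum_{i=1}^{n+1}(-1)^{i+1}\rho_T(\beta^{n-1}(v_i))\big(P(v_1,\dots,\widehat{v_i},\dots,v_{n+1})\big)+\sum_{i<j}(-1)^{i+j}P\big([v_i,v_j]^c,\beta(v_1),\dots,\widehat{\beta(v_i)},\dots,\widehat{\beta(v_j)},\dots,\beta(v_{n+1})\big).$$ $\widetilde{H}^*_{\beta,\alpha}(V,\mathfrak{g})$ is the cohomology of $\big(\bigoplus_{n\ge0}C^n_{\beta,\alpha}(V,\mathfrak{g}),\delta_{\beta,\alpha}\big)$. A linear deformation of $T$ generated by $\mathfrak{T}\in C^1_{\beta,\alpha}(V,\mathfrak{g})$ is $T_t=T+t\mathfrak{T}$ such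 that $T_t$ is an $\mathcal{O}$-operator on $(\mathfrak{g},[\cdot,\cdot],\alpha)$ with respect to $(V,\beta,\rho)$ for all $t\in k$; its generator $\mathfrak{T}$ is then a $1$-cocycle. A homomorphism from an $\mathcal{O}$-operator $T$ to an $\mathcal{O}$-operator $T'$ (both with respect to $(V,\beta,\rho)$) is a pair $(\phi_{\mathfrak{g}},\phi_V)$ with $\phi_{\mathfrak{g}}:\mathfrak{g}\to\mathfrak{g}$ a hom-Lie algebra homomorphism (linear, preserving the bracket and commuting with $\alpha$) and $\phi_V:V\to V$ linear such that $T'\circ\phi_V=\phi_{\mathfrak{g}}\circ T$, $\phi_V\circ\beta=\beta\circ\phi_V$ and $\phi_V(\rho(y)(v))=\rho(\phi_{\mathfrak{g}}(y))(\phi_V(v))$ for all $y\in\mathfrak{g},v\in V$. For $x$ with $\alpha(x)=x$ put $\mathrm{ad}_x^\dagger(y)=\alpha^{-1}([x,y])$ and $\rho(x)^\dagger(v)=\beta^{-1}(\rho(x)(v))$. Two linear deformations $T^1_t,T^2_t$ are equivalent if there is $x\in\mathfrak{g}$ with $\alpha(x)=x$ such that $(\mathrm{Id}_{\mathfrak{g}}+t\,\mathrm{ad}_x^\dagger,\mathrm{Id}_V+t\rho(x)^\dagger)$ is a homomorphism from $T^1_t$ to $T^2_t$ (for all $t$). *)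

(* Defs.v *)
From HB Require Import structures.
From mathcomp Require Import all_boot all_order all_algebra.
From mathcomp Require Import boolp classical_sets.

Set Implicit Arguments.
Unset Strict Implicit.
Unset Printing Implicit Defensive.

Import GRing.Theory.
Local Open Scope ring_scope.
Local Open Scope classical_set_scope.

(* Two-sided inverse of f whenever f is bijective (see inverseK, inverseVK);
   the value at points without a preimage is 0. *)
Definition inverse (k : nzRingType) (U : lmodType k) (f : U -> U) (y : U) : U :=
  xget 0 [set x | f x = y].

Lemma inverseVK (k : nzRingType) (U : lmodType k) (f : U -> U) :
  bijective f -> cancel (inverse f) f.
Proof.
case=> g fK gK y; rewrite /inverse; case: xgetP => [x _ //|/(_ (g y))] /=.
by rewrite gK.
Qed.

Lemma inverseK (k : nzRingType) (U : lmodType k) (f : U -> U) :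
  bijective f -> cancel f (inverse f).
Proof. by move=> bf x; apply: (bij_inj bf); rewrite inverseVK. Qed.

Record homLie (k : fieldType) := HomLie {
  hl_carrier :> lmodType k;
  bracket : {bilinear hl_carrier -> hl_carrier -> hl_carrier};
  twist : {linear hl_carrier -> hl_carrier};
  bracket_skew : forall x y, bracket x y = - bracket y x;
  twist_bracket : forall x y,
    twist (bracket x y) = bracket (twist x) (twist y);
  hom_jacobi : forall x y z,
    bracket (twist x) (bracket y z) + bracket (twist y) (bracket z x)
      + bracket (twist z) (bracket x y) = 0
}.
Arguments bracket {k} _.
Arguments twist {k} _.

Definition regular (k : fieldType) (g : homLie k) : Prop := bijective (twist g).

(* action x v is {x, v} = rho(x)(v); a linear map rho : g -> End(V) is the same
   thing as a bilinear map g -> V -> V. *)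
Record representation (k : fieldType) (g : homLie k) := Representation {
  rep_carrier :> lmodType k;
  rep_twist : {linear rep_carrier -> rep_carrier};
  action : {bilinear g -> rep_carrier -> rep_carrier};
  action_twist : forall x v,
    action (twist g x) (rep_twist v) = rep_twist (action x v);
  action_bracket : forall x y v,
    action (bracket g x y) (rep_twist v)
      = action (twist g x) (action y v) - action (twist g y) (action x v)
}.
Arguments rep_twist {k g} _.
Arguments action {k g} _.

Section OOperators.
Variables (k : fieldType) (g : homLie k) (V : representation g).

Local Notation "⟦ x , y ⟧" := (bracket g x y).
Local Notation "x ∙ v" := (action V x v) (at level 40).
Local Notation alpha := (twist g).
Local Notation beta := (rep_twist V).

Definition O_operator (T : V -> g) : Prop :=
  [/\ linear T,
      forall v, T (beta v) = alpha (T v)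
    & forall u v, ⟦T u, T v⟧ = T (T u ∙ v - T v ∙ u)].

Definition homLie_morphism (phi : g -> g) : Prop :=
  [/\ linear phi,
      forall x y, phi ⟦x, y⟧ = ⟦phi x, phi y⟧
    & forall x, phi (alpha x) = alpha (phi x)].

Definition O_operator_morphism (T T' : V -> g) (phig : g -> g) (phiV : V -> V)
    : Prop :=
  [/\ homLie_morphism phig,
      linear phiV,
      forall v, T' (phiV v) = phig (T v),
      forall v, phiV (beta v) = beta (phiV v)
    & forall y v, phiV (y ∙ v) = phig y ∙ phiV v].

(* An n-linear function of v_1, ..., v_n is a function of the family
   v : 'I_n -> V, indexed from 0. *)
Definition nfun (n : nat) := ('I_n -> V) -> g.

Definition multilinear n (P : nfun n) : Prop :=
  forall (i : 'I_n) (v : 'I_n -> V),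
    linear (fun x : V => P (fun j => if j == i then x else v j)).

Definition alternating n (P : nfun n) : Prop :=
  forall (v : 'I_n -> V) (i j : 'I_n), i != j -> v i = v j -> P v = 0.

(* The space C^n. There is exactly one family 'I_0 -> V, so an element of nfun 0
   is an element of g, and C^0 is the fixed space of alpha (see cochain0P). *)
Definition cochain n : set (nfun n) := [set P |
  [/\ multilinear P, alternating P
    & forall v, alpha (P v) = P (fun i => beta (v i))]].

Lemma cochain0P (P : nfun 0) :
  cochain P <-> exists2 x : g, alpha x = x & P = fun=> x.
Proof.
have v0 (v w : 'I_0 -> V) : v = w by apply: funext => -[].
split=> [[_ _ Pa]|[x ax ->]].
  exists (P (fun=> 0)); last by apply: funext => v; rewrite (v0 v (fun=> 0)).
  by rewrite Pa; congr P; exact: v0.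
by split=> // [[]//|v []].
Qed.

Section Differential.
Variable T : V -> g.

Definition rhoT (v : V) (x : g) : g := ⟦T v, x⟧ + T (x ∙ v).

Definition cbracket (v w : V) : V := T v ∙ w - T w ∙ v.

Definition fcons n (x : V) (w : 'I_n -> V) (i : 'I_n.+1) : V :=
  if unlift ord0 i is Some j then w j else x.

(* v with its entries i and j removed, for i < j (then i <= m, so that inord i
   has value i, and removing i after j does not shift i). *)
Definition omit2 m (v : 'I_m.+2 -> V) (i j : 'I_m.+2) (l : 'I_m) : V :=
  v (lift j (lift (inord i : 'I_m.+1) l)).

(* Indices start at 0, which does not change the parity of i + j and turns
   (-1)^(i+1) into (-1)^i. *)
Definition differential n : nfun n -> nfun n.+1 :=
  match n return nfun n -> nfun n.+1 with
  | 0 => fun P v => rhoT (inverse beta (v ord0)) (P (v \o lift ord0))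
  | m.+1 => fun P v =>
      \sum_(i < m.+2) (-1) ^+ i *: rhoT (iter m beta (v i)) (P (v \o lift i))
      + \sum_(i < m.+2) \sum_(j < m.+2 | (i < j)%N)
          (-1) ^+ (i + j) *:
          P (fcons (cbracket (v i) (v j)) (fun l => beta (omit2 v i j l)))
  end.

Definition cocycle n : set (nfun n) :=
  [set P | cochain P /\ forall v, differential P v = 0].

Definition coboundary n : set (nfun n) :=
  match n return set (nfun n) with
  | 0 => [set P | forall v, P v = 0]
  | m.+1 => [set P | exists2 Q : nfun m,
                       cochain Q & forall v, P v = differential Q v]
  end.

Definition cohomology_class n (P : nfun n) : set (nfun n) :=
  [set Q | cocycle Q /\ coboundary (fun v => Q v - P v)].

(* The underlying set of the quotient of cocycles by coboundaries. *)
Definition cohomology n : set (set (nfun n)) :=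
  [set cohomology_class P | P in cocycle (n := n)].

End Differential.

(* A map V -> g viewed as a function of one vector argument. *)
Definition nfun1 (f : V -> g) : nfun 1 := fun v => f (v ord0).

Definition deform (T S : V -> g) (t : k) (v : V) : g := T v + t *: S v.

Definition linear_deformation (T S : V -> g) : Prop :=
  cochain (nfun1 S) /\ forall t : k, O_operator (deform T S t).

Definition ad_dagger (x y : g) : g := inverse alpha ⟦x, y⟧.

Definition rho_dagger (x : g) (v : V) : V := inverse beta (x ∙ v).

(* The linear deformations T + t S1 and T + t S2 are equivalent. *)
Definition equivalent_deformations (T S1 S2 : V -> g) : Prop :=
  exists2 x : g, alpha x = x &
    forall t : k,
      O_operator_morphism (deform T S1 t) (deform T S2 t)
        (fun y => y + t *: ad_dagger x y) (fun v => v + t *: rho_dagger x v).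

End OOperators.

Arguments O_operator {k g} V T.
Arguments cochain {k g} V n%_N.
Arguments cocycle {k g} V T n%_N.
Arguments coboundary {k g} V T n%_N.
Arguments cohomology {k g} V T n%_N.
Arguments linear_deformation {k g} V T S.
Arguments equivalent_deformations {k g} V T S1 S2.

(* Main.v *)
From HB Require Import structures.
Require Import Defs.
From mathcomp Require Import all_boot all_order all_algebra.
From mathcomp Require Import boolp classical_sets.
Import GRing.Theory.
Local Open Scope ring_scope.

(** Both halves come from comparing coefficients of t.  In the O-operator
    identity for T + t S the linear term says that S is a 1-cocycle.  In
    (T + t S2)(v + t rho(x)^dagger v) = (Id + t ad_x^dagger)(T v + t S1 v) it
    says S1 v - S2 v = T (rho(x)^dagger v) - ad_x^dagger (T v); since x is fixed
    by alpha, the inverse twists can be moved onto v, and the right-hand side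
    becomes rho_T (beta^-1 v) x = delta x v. *)

(** On each side the even terms take the same value at [t = 1] and [t = -1], so subtracting these
    two instances leaves [2 b = 2 b']. The other coefficients need not be matched beforehand. *)
Lemma quadratic_coef1_inj {k : fieldType} {U : lmodType k} {a b c a' b' c' : U} :
  (2%:R : k) != 0 ->
  (forall t : k, a + t *: b + t ^+ 2 *: c = a' + t *: b' + t ^+ 2 *: c') ->
  b = b'.
Proof.
move=> two_neq0 eq_abc.
have doubleE (x y z : U) : x + 1 *: y + 1 ^+ 2 *: z
    - (x + -1 *: y + (-1) ^+ 2 *: z) = 2%:R *: y.
  by rewrite sqrrN scaleN1r scale1r !opprD addrACA subrr addr0 addrACA subrr add0r
             opprK scaler_nat mulr2n.
by apply: (scalerI two_neq0); rewrite -(doubleE a b c) !eq_abc doubleE.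
Qed.

(** Trades a bare linear function for a bundled one, to which the rewriting lemmas for linear maps
    apply. *)
Lemma linear_fun {k : fieldType} {U W : lmodType k} {f : U -> W} :
  linear f -> exists h : {linear U -> W}, f = h.
Proof.
move=> flin; pose h : {linear U -> W} :=
  HB.pack f (GRing.isLinear.Build k U W _ f flin).
by exists h.
Qed.

Lemma inverse_linear {k : fieldType} {U : lmodType k} {f : {linear U -> U}} :
  bijective f -> linear (inverse f).
Proof.
move=> f_bij a x y; apply: (bij_inj f_bij).
by rewrite linearP !inverseVK.
Qed.

Section Deformations.
Context {k : fieldType} {g : homLie k} {V : representation g}.

Local Notation alpha := (twist g).
Local Notation beta := (rep_twist V).

Lemma cochain_nfun1_linear {S : V -> g} : cochain V 1 (nfun1 S) -> linear S.
Proof. by case=> /(_ ord0 (fun=> 0)) lin _ _. Qed.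

(** In degree one the iterate of [beta] is the zeroth, and the only pair [i < j] is [(0, 1)], with
    sign [-1]; the bracket [cbracket T u w] fills the single slot. *)
Lemma differential_nfun1 (T : V -> g) (S : V -> g) (v : 'I_2 -> V) :
  let u := v ord0 in let w := v ord_max in
  differential T (nfun1 S) v
  = rhoT T u (S w) - rhoT T w (S u) - S (cbracket T u w).
Proof.
rewrite /differential /nfun1 /=.
have e1 : lift ord0 ord0 = ord_max :> 'I_2 by apply: val_inj.
have e0 : lift ord_max ord0 = ord0 :> 'I_2 by apply: val_inj.
rewrite big_ord_recl big_ord1 /= e1 e0.
rewrite (big_ord_recl 1) (big_ord1 _ (fun i => \sum_(j < 2 | (lift ord0 i < j)%N) _)).
(* Once the constraints [i < j] are conditionals on concrete indices they evaluate, and a single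
   term of the double sum survives. *)
rewrite !(big_mkcond (fun j : 'I_2 => (_ < j)%N)) !(big_ord_recl 1) !big_ord1 /=.
rewrite e1 /fcons unlift_none /=.
by rewrite !add0r !addr0 expr0 expr1 scale1r !scaleN1r.
Qed.

Lemma deform_affine (T S : {linear V -> g}) (t : k) (p q : V) :
  deform T S t (p + t *: q) = T p + t *: (T q + S p) + t ^+ 2 *: S q.
Proof. by rewrite /deform !linearD !linearZ_LR scalerA !addrA. Qed.

Lemma bracket_deform (T S : V -> g) (t : k) (u w : V) :
  bracket g (deform T S t u) (deform T S t w)
  = bracket g (T u) (T w) + t *: (bracket g (T u) (S w) + bracket g (S u) (T w))
    + t ^+ 2 *: bracket g (S u) (S w).
Proof.
rewrite /deform linearDl !linearDr !linearZl_LR !linearZr_LR.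
by rewrite scalerDr scalerA !addrA.
Qed.

Lemma cbracket_deform (T S : V -> g) (t : k) (u w : V) :
  cbracket (deform T S t) u w = cbracket T u w + t *: cbracket S u w.
Proof.
by rewrite /cbracket /deform !linearDl !linearZl_LR scalerBr opprD addrACA.
Qed.

Lemma linear_deformation_cocycle {T S : V -> g} : (2%:R : k) != 0 ->
  linear T -> linear_deformation V T S -> cocycle V T 1 (nfun1 S).
Proof.
move=> two_neq0 /linear_fun[T' ->] [Sco defS]; split=> // v.
have /linear_fun[S' eS] := cochain_nfun1_linear Sco; subst S.
rewrite differential_nfun1; set u := v _; set w := v _.
(* The coefficients of [t] in the O-operator identity for [T' + t S'] at [u], [w]. *)
have coef1 : bracket g (T' u) (S' w) + bracket g (S' u) (T' w)
    = T' (cbracket S' u w) + S' (cbracket T' u w).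
  apply: (quadratic_coef1_inj two_neq0) => t.
  have [_ _ /(_ u w)] := defS t.
  rewrite -/(cbracket _ u w) bracket_deform cbracket_deform deform_affine.
  exact.
apply/eqP; rewrite subr_eq0; apply/eqP.
(* The added term cancels the action terms of the two [rhoT] summands; up to skew symmetry the
   brackets of [coef1] remain. *)
apply: (addrI (T' (cbracket S' u w))); rewrite -coef1 /rhoT.
rewrite [bracket g (S' u) _]bracket_skew /cbracket linearB /=.
by rewrite opprD [X in _ + X]addrACA [X in _ + X]addrC !addrA subrK subrr add0r.
Qed.

(** For [x] fixed by [alpha], [action_twist] says that acting by [x] commutes with [beta], hence
    with its inverse. *)
Lemma inverse_action_fixed {x : g} {v : V} :
  bijective beta -> alpha x = x ->
  inverse beta (action V x v) = action V x (inverse beta v).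
Proof.
move=> beta_bij ax; apply: (bij_inj beta_bij).
by rewrite -action_twist ax !inverseVK.
Qed.

Lemma inverse_bracket_fixed {x y : g} :
  bijective alpha -> alpha x = x ->
  inverse alpha (bracket g x y) = bracket g x (inverse alpha y).
Proof.
move=> alpha_bij ax; apply: (bij_inj alpha_bij).
by rewrite twist_bracket ax !inverseVK.
Qed.

Lemma inverse_twist_intertwine {T : V -> g} {v : V} :
  bijective alpha -> bijective beta -> (forall v, T (beta v) = alpha (T v)) ->
  inverse alpha (T v) = T (inverse beta v).
Proof.
move=> alpha_bij beta_bij Tb; apply: (bij_inj alpha_bij).
by rewrite -Tb !inverseVK.
Qed.

Lemma equivalent_deformations_sub {T S1 S2 : V -> g} :
  (2%:R : k) != 0 -> bijective alpha -> bijective beta ->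
  O_operator V T -> linear S2 ->
  equivalent_deformations V T S1 S2 ->
  exists2 x : g, alpha x = x &
    forall v, S1 v - S2 v = rhoT T (inverse beta v) x.
Proof.
move=> two_neq0 alpha_bij beta_bij [Tlin Tb _] /linear_fun[S2' ->] [x ax S12].
have /linear_fun[T' eT] := Tlin; subst T.
exists x => // v.
have coef1 : T' (rho_dagger x v) + S2' v = S1 v + ad_dagger x (T' v).
  apply: (quadratic_coef1_inj two_neq0 (a := T' v)
    (c := S2' (rho_dagger x v)) (a' := T' v) (c' := ad_dagger x (S1 v))) => t.
  have [_ _ /(_ v) + _ _] := S12 t; rewrite deform_affine /deform => ->.
  rewrite /ad_dagger !inverse_bracket_fixed //.
  (* Linearity of the inverse twist lets [ad_dagger x (T' v + t *: S1 v)] be expanded in powers of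
     [t]. *)
  have /linear_fun[A ->] := inverse_linear alpha_bij.
  by rewrite !linearD !linearZ_LR scalerA !addrA.
have -> : S1 v - S2' v = T' (rho_dagger x v) - ad_dagger x (T' v).
  by apply/eqP; rewrite subr_eq addrAC coef1 addrK.
rewrite /rho_dagger /ad_dagger inverse_action_fixed // inverse_bracket_fixed //.
(* Skew symmetry absorbs the sign of the [ad_dagger] term, which becomes the bracket term of
   [rhoT]. *)
by rewrite (inverse_twist_intertwine _ _ Tb) // bracket_skew opprK addrC.
Qed.
End Deformations.

Theorem theorem4p2 (k : fieldType) (k_char0 : [pchar k] =i pred0)
    (g : homLie k) (g_regular : regular g)
    (V : representation g) (beta_bij : bijective (rep_twist V))
    (T : V -> g) (T_oper : O_operator V T)
    (S1 S2 : V -> g)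
    (S1_deform : linear_deformation V T S1)
    (S2_deform : linear_deformation V T S2)
    (S12_equiv : equivalent_deformations V T S1 S2) :
  exists2 c, cohomology V T 1 c & c (nfun1 S1) /\ c (nfun1 S2).
Proof.
have two_neq0 : (2%:R : k) != 0 by rewrite (pcharf0P _).1.
have [T_lin _ _] := T_oper.
have S1_cocycle := linear_deformation_cocycle two_neq0 T_lin S1_deform.
have S2_cocycle := linear_deformation_cocycle two_neq0 T_lin S2_deform.
have S2_lin := cochain_nfun1_linear S2_deform.1.
have [x ax S12] := equivalent_deformations_sub two_neq0 g_regular beta_bij
  T_oper S2_lin S12_equiv.
(* Representing the class by [S2] makes the difference to be bounded [S1 - S2], which is exactly the
   differential of [x]. *)
exists (cohomology_class T (nfun1 S2)); first by exists (nfun1 S2).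
split; split=> //.
  by exists (fun=> x); [apply/cochain0P; exists x | move=> v; apply: S12].
(* For [S2] itself the difference is zero, bounded by the zero 0-cochain. *)
exists (fun=> 0); first by apply/cochain0P; exists 0; rewrite ?linear0.
have /linear_fun[T' eT] := T_lin; subst T.
by move=> v; rewrite subrr /= /rhoT linear0r linear0l linear0 addr0.
Qed.
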